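(* A collection $\mathcal C$ of languages over a countably infinite universe $U$ is generatable in the limit without samples if and only if there exists a countable sequence of collections $\mathcal C_0\subseteq\mathcal C_1\subseteq\cdots$ such that $\mathcal C=\bigcup_{i\in\mathbb N}\mathcal C_i$ and $\bigl|\bigcap_{L\in\mathcal C_i}L\bigr|=\infty$ for all $i\in\mathbb N$.
   Context: A language is an infinite subset of $U$; a collection is a (possibly uncountable) set of languages. A generator without samples is an injection $G:\mathbb N\to U$, with output $z_t=G(t)$ at time $t$. $G$ generates in the limit without samples for $\mathcal C$ if for every $K\in\mathcal C$ there exists $t^\star$ such that $z_t\in K$ for all $t\ge t^\star$; $\mathcal C$ is generatable in the limit without samples if such a $G$ exists. *)

(* Defs.v *)
From mathcomp Require Import all_boot.
From mathcomp Require Import all_classical.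

Set Implicit Arguments.
Unset Strict Implicit.
Unset Printing Implicit Defensive.

Local Open Scope classical_set_scope.

Section Generation.
Variable U : Type.

Definition language (L : set U) : Prop := infinite_set L.

Definition collection (C : set (set U)) : Prop := forall L, C L -> language L.

Definition generates_without_samples (G : nat -> U) (C : set (set U)) : Prop :=
  forall K, C K -> exists tstar : nat, forall t : nat, tstar <= t -> K (G t).

Definition generatable_without_samples (C : set (set U)) : Prop :=
  exists G : nat -> U, injective G /\ generates_without_samples G C.

End Generation.

(* Main.v *)
(** If [G] generates, let [C_i] collect the languages of [C] containing every
    [G t] with [t >= i]: their intersection contains the infinite tail of [G].
    Conversely, the intersections of the [C_i] are infinite, so one can pick
    [G t] in the [t]-th one, distinct from the earlier outputs; since the
    [C_i] increase, a language of [C_i] contains [G t] for all [t >= i]. *)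
Require Import Defs.
From mathcomp Require Import all_boot.
From mathcomp Require Import all_classical.

Local Open Scope classical_set_scope.

(** If the image were finite, so would be its preimage under the injective [G], and adding the
    indices below [i] would make [nat] finite. *)
Lemma infinite_tail_image (U : Type) (G : nat -> U) (i : nat) :
  injective G -> infinite_set [set G t | t in [set t | i <= t]].
Proof.
move=> Ginj finT; apply: infinite_nat.
apply: (@sub_finite_set _ _ (`I_i `|` [set t | i <= t])).
  by move=> t _ /=; case: (ltnP t i) => h; [left|right].
rewrite finite_setU; split; first exact: finite_II.
apply: (sub_finite_set (@preimage_image _ _ G _)).
by apply: finite_preimage finT => x y _ _; apply: Ginj.
Qed.

Lemma injective_selection (U : Type) (A : nat -> set U) :
  (forall t, infinite_set (A t)) ->
  exists2 G : nat -> U, injective G & forall t, A t (G t).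
Proof.
move=> Ainf.
(* Finiteness of [p.1] is a premise inside the existential, so that [choice] gives a total [g]; for
   infinite [p.1] the point is a dummy. *)
have fresh (p : set U * nat) :
    exists x, finite_set p.1 -> A p.2 x /\ ~ p.1 x.
  have [finF|] := pselect (finite_set p.1).
    have [x Dx] : A p.2 `\` p.1 !=set0 by apply/infinite_setN0/infinite_setD.
    by exists x.
  have [x _] : A p.2 !=set0 by apply/infinite_setN0/Ainf.
  by exists x.
have [g gP] := choice fresh.
(* [F t] is the set of outputs before time [t]. *)
pose F := fix F t := if t is s.+1 then F s `|` [set g (F s, s)] else set0.
have finF t : finite_set (F t).
  by elim: t => [|t IH] /=; [|rewrite finite_setU].
have F_g s t : s < t -> F t (g (F s, s)).
  elim: t => // t IH; rewrite ltnS leq_eqVlt => /orP[/eqP->|/IH]; first by right.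
  by left.
exists (fun t => g (F t, t)) => [s t /= gst|t]; last first.
  by have [] := gP (F t, t) (finF t).
(* If two outputs agree, the later one lies in the set it was chosen to avoid. *)
case: (ltngtP s t) => // lst.
- by case: (gP (F t, t) (finF t)) => _ []; rewrite -gst; apply: F_g.
- by case: (gP (F s, s) (finF s)) => _ []; rewrite gst; apply: F_g.
Qed.

Theorem theorem1p3 (U : Type) (U_countable : countable [set: U])
    (U_infinite : infinite_set [set: U])
    (C : set (set U)) (C_collection : collection C) :
  generatable_without_samples C <->
  exists Cs : nat -> set (set U),
    [/\ forall i : nat, collection (Cs i),
        forall i : nat, Cs i `<=` Cs i.+1,
        C = \bigcup_(i in [set: nat]) Cs i
      & forall i : nat, infinite_set (\bigcap_(L in Cs i) L)].
Proof.
split=> [[G [Ginj Ggen]]|[Cs [_ Cs_incr -> Cs_inf]]].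
  exists (fun i => [set K | C K /\ forall t, i <= t -> K (G t)]); split.
  - by move=> i K [/C_collection].
  - by move=> i K [CK KG]; split=> // t /ltnW; apply: KG.
  - apply/seteqP; split=> [K CK|K [i _ []]//].
    by have [i KG] := Ggen K CK; exists i.
  - move=> i; apply: sub_infinite_set (infinite_tail_image U G i Ginj).
    by move=> _ [t it <-] K [_]; apply.
have [G Ginj GCs] := injective_selection U _ Cs_inf.
exists G; split=> // K [i _ CiK]; exists i => t it.
(* It remains to see [Cs t K]: with [t] written as [t - i + i], induct on [t - i]. *)
apply: GCs; move: it CiK => /subnK <-.
by elim: (t - i) => [|n IH] // /IH; apply: Cs_incr.
Qed.
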